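(* Let $\mathcal{G}(\mathcal{N},\mathcal{E})$ be a finite connected undirected graph with root $0\in\mathcal{N}$, let $R_{ij}=R_{ji}>0$ be the resistance of edge $\{i,j\}\in\mathcal{E}$, and let $p_k,q_k$ ($k\in\mathcal{N}$) be real demands. For $A\subseteq\mathcal{E}$ define $$f(A)=\sum_{(i,j)\in\mathcal{N}\times\mathcal{N}:\ \{i,j\}\in\mathcal{E}} R_{ij}\, z_{ji}^0(A)\left[\left(\sum_{k\in\mathcal{N}} z_{ij}^k(A)\, p_k\right)^2+\left(\sum_{k\in\mathcal{N}} z_{ij}^k(A)\, q_k\right)^2\right],$$ where $z_{ij}^k(A)$ is the number of simple paths from $i$ to $k$ that use only edges of $A$ and whose first edge is $\{i,j\}$. If all the $p_k$ and $q_k$ are non-negative, then $f:2^{\mathcal{E}}\to\mathbb{R}$ is a supermodular set function over $\mathcal{E}$.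
   Context: A set function $f:2^V\to\mathbb{R}$ on a finite ground set $V$ is submodular if $f(X\cup\{u\})-f(X)\ge f(Y\cup\{u\})-f(Y)$ for all $X\subseteq Y\subseteq V$ and $u\in V\setminus Y$; it is supermodular if $-f$ is submodular, i.e. if the reverse inequality always holds. The outer sum in the definition of $f$ runs over ordered pairs $(i,j)$, so each edge $\{i,j\}$ contributes one term for each of its two orientations. A simple path visits no vertex twice; in particular $z_{ij}^i(A)=0$, and $z_{ij}^k(A)=0$ for all $k$ whenever $\{i,j\}\notin A$. The number $z_{ji}^0(A)$ is thus the number of simple paths in $A$ from $j$ to the root $0$ whose first edge is $\{j,i\}$. The root carries no load: $p_0=q_0=0$. *)

(* Defs.v *)
From mathcomp Require Import all_boot all_order all_algebra.

Set Implicit Arguments.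
Unset Strict Implicit.
Unset Printing Implicit Defensive.

Import Order.TTheory GRing.Theory Num.Theory.
Local Open Scope ring_scope.

(* The ground set V is a subset of a finite type T; the values of f outside
   the subsets of V are irrelevant. *)
Definition submodular (T : finType) (K : realFieldType) (V : {set T})
    (f : {set T} -> K) : Prop :=
  forall (X Y : {set T}) (u : T),
    X \subset Y -> Y \subset V -> u \in V :\: Y ->
    f (u |: X) - f X >= f (u |: Y) - f Y.

Definition supermodular (T : finType) (K : realFieldType) (V : {set T})
    (f : {set T} -> K) : Prop :=
  submodular V (fun X => - f X).

(* Undirected graphs on N are given by their edge sets; an edge is a
   two-element set of vertices. *)
Definition edge_set (N : finType) (E : {set {set N}}) : Prop :=
  forall e : {set N}, e \in E -> #|e| = 2%N.

Definition adj (N : finType) (A : {set {set N}}) : rel N :=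
  [rel x y | [set x; y] \in A].

Definition connected_graph (N : finType) (E : {set {set N}}) : Prop :=
  forall x y : N, connect (adj E) x y.

(* The vertex sequence i :: s is a simple path from i to k in A with first
   edge {i, j}. *)
Definition simple_path (N : finType) (A : {set {set N}}) (i j k : N)
    (s : seq N) : bool :=
  [&& path (adj A) i s, uniq (i :: s), ohead s == Some j & last i s == k].

Lemma simple_path_size (N : finType) (A : {set {set N}}) (i j k : N)
    (s : seq N) : simple_path A i j k s -> (size s < #|N|)%N.
Proof.
case/and4P=> _ us _ _.
by rewrite -[(size s).+1]/(size (i :: s)) -(card_uniqP us) max_card.
Qed.

(* z_ij^k(A). By simple_path_size, the sum over the number n of edges, for
   n < #|N|, accounts for all simple paths. *)
Definition num_paths (N : finType) (A : {set {set N}}) (i j k : N) : nat :=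
  (\sum_(n < #|N|) #|[set s : n.-tuple N | simple_path A i j k s]|)%N.

Definition loss (N : finType) (K : realFieldType) (E : {set {set N}})
    (root : N) (res : N -> N -> K) (p q : N -> K) (A : {set {set N}}) : K :=
  \sum_(ij : N * N | [set ij.1; ij.2] \in E)
    res ij.1 ij.2 * (num_paths A ij.2 ij.1 root)%:R *
    ((\sum_(k : N) (num_paths A ij.1 ij.2 k)%:R * p k) ^+ 2 +
     (\sum_(k : N) (num_paths A ij.1 ij.2 k)%:R * q k) ^+ 2).

(* Main.v *)
Require Import Defs.
From mathcomp Require Import all_boot all_order all_algebra.
From mathcomp Require Import ring lra.

(** The loss is a polynomial with non-negative coefficients (resistances and
    demands) in the path counts [num_paths A i j k].  Each path count is a sum,
    over vertex sequences, of indicators of the event that every edge of a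
    fixed sequence lies in [A], and such an indicator is non-negative,
    nondecreasing and supermodular in [A].  These three properties together
    define a class that contains the non-negative constants and is closed under
    sums and, unlike supermodularity alone, under products, so it contains the
    loss.

    The two facts that carry the argument are [cone_indicator] (indicators of
    intersection-compatible properties belong to the class) and [cone_mul]
    (closure under products). *)

Import Order.TTheory GRing.Theory Num.Theory.
Local Open Scope ring_scope.

Definition monotone_supermodular_cone (T : finType) (K : realFieldType)
    (g : {set T} -> K) : Prop :=
  [/\ forall X, 0 <= g X,
      forall X Y : {set T}, X \subset Y -> g X <= g Y
    & forall (X Y : {set T}) (u : T), X \subset Y -> u \notin Y ->
        g (u |: X) - g X <= g (u |: Y) - g Y].

Lemma cone_const (T : finType) (K : realFieldType) (c : K) :
  0 <= c -> monotone_supermodular_cone T K (fun=> c).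
Proof. by move=> c_ge0; split=> *; rewrite ?subrr. Qed.

Lemma cone_sum (T : finType) (K : realFieldType) (I : finType) (P : pred I)
    (F : I -> {set T} -> K) :
  (forall i, P i -> monotone_supermodular_cone T K (F i)) ->
  monotone_supermodular_cone T K (fun X => \sum_(i | P i) F i X).
Proof.
move=> F_cone; split=> [X|X Y sXY|X Y u sXY uY].
- by apply: sumr_ge0 => i /F_cone[].
- by apply: ler_sum => i /F_cone[_ F_mono _]; apply: F_mono.
- rewrite -!sumrB; apply: ler_sum => i /F_cone[_ _ F_super].
  exact: F_super.
Qed.

Lemma cone_add (T : finType) (K : realFieldType) (g h : {set T} -> K) :
  monotone_supermodular_cone T K g -> monotone_supermodular_cone T K h ->
  monotone_supermodular_cone T K (fun X => g X + h X).
Proof.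
move=> [g_ge0 g_mono g_super] [h_ge0 h_mono h_super].
split=> [X|X Y sXY|X Y u sXY uY].
- exact: addr_ge0.
- by apply: lerD; [apply: g_mono | apply: h_mono].
- have := g_super _ _ _ sXY uY; have := h_super _ _ _ sXY uY; lra.
Qed.

(** The increment of a product obeys the Leibniz rule
    [(g X' - g X) * h X' + g X * (h X' - h X)].  All four factors are
    non-negative and grow with [X]: the increments by monotonicity and
    supermodularity, the values by non-negativity and monotonicity. *)
Lemma cone_mul (T : finType) (K : realFieldType) (g h : {set T} -> K) :
  monotone_supermodular_cone T K g -> monotone_supermodular_cone T K h ->
  monotone_supermodular_cone T K (fun X => g X * h X).
Proof.
move=> [g_ge0 g_mono g_super] [h_ge0 h_mono h_super].
split=> [X|X Y sXY|X Y u sXY uY].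
- exact: mulr_ge0.
- by apply: ler_pM; rewrite ?g_mono ?h_mono.
- have leibniz Z : g (u |: Z) * h (u |: Z) - g Z * h Z =
      (g (u |: Z) - g Z) * h (u |: Z) + g Z * (h (u |: Z) - h Z) by ring.
  rewrite !leibniz.
  apply: lerD; apply: ler_pM; rewrite ?subr_ge0 //.
  + by rewrite g_mono ?subsetUr.
  + exact: g_super.
  + by rewrite h_mono ?setUS.
  + by rewrite h_mono ?subsetUr.
  + exact: g_mono.
  + exact: h_super.
Qed.

(** Of the four values at [X], [u |: X], [Y], [u |: Y], the only pattern
    compatible with monotonicity that would violate supermodularity has the
    property at [u |: X] and at [Y] but not at [X]; it is excluded because
    [(u |: X) :&: Y = X] when [u \notin Y]. *)
Lemma cone_indicator (T : finType) (K : realFieldType) (b : pred {set T}) :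
  (forall A B, b (A :&: B) = b A && b B) ->
  monotone_supermodular_cone T K (fun X => (b X)%:R).
Proof.
move=> bI.
have b_mono (X Y : {set T}) : X \subset Y -> b X -> b Y.
  by move=> /setIidPl sXY; rewrite -sXY bI => /andP[].
split=> [X|X Y sXY|X Y u sXY uY].
- exact: ler0n.
- by rewrite ler_nat; have := b_mono _ _ sXY; case: (b X) => // ->.
- have uX : u \notin X by apply: contra uY; apply: (subsetP sXY).
  have bX : b X = b (u |: X) && b Y.
    rewrite -bI; congr b; apply/setP => x; rewrite !inE.
    have [->|_] /= := eqVneq x u; first by rewrite (negPf uX) (negPf uY).
    by have := subsetP sXY x; case: (x \in X) => // ->.
  have /implyP := b_mono _ _ (setUS [set u] sXY).
  have /implyP := b_mono _ _ (subsetUr [set u] Y).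
  rewrite bX; case: (b (u |: X)); case: (b Y); case: (b (u |: Y)) => //= _ _;
    lra.
Qed.

Lemma simple_pathI (N : finType) (A B : {set {set N}}) (i j k : N)
    (s : seq N) :
  simple_path (A :&: B) i j k s = simple_path A i j k s && simple_path B i j k s.
Proof.
rewrite /simple_path.
have -> : path (adj (A :&: B)) i s = path (adj A) i s && path (adj B) i s.
  by rewrite -path_relI; apply: eq_path => x y; rewrite /adj /= inE.
by case: (path (adj A) i s); case: (path (adj B) i s); rewrite //= ?andbb ?andbF.
Qed.

Lemma cone_num_paths (N : finType) (K : realFieldType) (i j k : N) :
  monotone_supermodular_cone {set N} K (fun A => (num_paths A i j k)%:R).
Proof.
pose F (A : {set {set N}}) : K :=
  \sum_(n < #|N|) \sum_(s : n.-tuple N) (simple_path A i j k s)%:R.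
have numE A : (num_paths A i j k)%:R = F A.
  rewrite /num_paths natr_sum; apply: eq_bigr => n _.
  rewrite -sum1_card natr_sum big_mkcond /=.
  by apply: eq_bigr => s _; rewrite inE; case: simple_path.
have [F_ge0 F_mono F_super] : monotone_supermodular_cone {set N} K F.
  apply: cone_sum => n _; apply: cone_sum => s _.
  by apply: cone_indicator => A B; apply: simple_pathI.
by split=> *; rewrite !numE; [apply: F_ge0 | apply: F_mono | apply: F_super].
Qed.

Lemma cone_load (N : finType) (K : realFieldType) (d : N -> K) (i j : N) :
  (forall k, 0 <= d k) ->
  monotone_supermodular_cone {set N} K
    (fun A => (\sum_(k : N) (num_paths A i j k)%:R * d k) ^+ 2).
Proof.
move=> d_ge0.
have load_cone : monotone_supermodular_cone {set N} K
    (fun A => \sum_(k : N) (num_paths A i j k)%:R * d k).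
  apply: cone_sum => k _; apply: cone_mul; first exact: cone_num_paths.
  exact: cone_const.
exact: (cone_mul _ _ _ _ load_cone load_cone).
Qed.

Theorem theorem4 (K : realFieldType) (N : finType) (E : {set {set N}})
    (root : N) (res : N -> N -> K) (p q : N -> K)
    (E_edges : edge_set E)
    (E_conn : connected_graph E)
    (res_sym : forall i j : N, [set i; j] \in E -> res i j = res j i)
    (res_gt0 : forall i j : N, [set i; j] \in E -> 0 < res i j)
    (p_root : p root = 0) (q_root : q root = 0)
    (p_ge0 : forall k : N, 0 <= p k) (q_ge0 : forall k : N, 0 <= q k) :
  supermodular E (loss E root res p q).
Proof.
have [_ _ loss_super] :
    monotone_supermodular_cone {set N} K (loss E root res p q).
  apply: cone_sum => ij ijE; apply: cone_mul.
    apply: cone_mul; last exact: cone_num_paths.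
    by apply: cone_const; rewrite ltW ?res_gt0.
  by apply: cone_add; apply: cone_load.
move=> X Y u sXY _; rewrite inE => /andP[uY _].
have := loss_super X Y u sXY uY; lra.
Qed.
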